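(* Let $R$ be a non-zero ring with $3\in J(R)$, let $p$ be a prime and let $G$ be a $p$-group. If the group ring $RG$ is a 2-UQ ring, then either $G$ is a 3-group or $G$ is a group of exponent 2.
   Context: Rings are associative with unity, not necessarily commutative. $J(R)$ is the Jacobson radical and $U(R)$ the set of units of $R$. An element $a\in R$ is quasi-nilpotent if $1-ax$ is invertible for every $x\in R$ with $ax=xa$; $QN(R)$ is the set of quasi-nilpotent elements. $R$ is 2-UQ if the square of each unit is the sum of an idempotent and a quasi-nilpotent element that commute with each other; equivalently, for each $u\in U(R)$, $u^2=1+q$ with $q\in QN(R)$. For a prime $p$, a group is a $p$-group if the order of each of its elements is a (finite) power of $p$ (the trivial group is a $p$-group for every $p$). $RG$ denotes the group ring of $G$ over $R$. *)

(* Defs.v *)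
From HB Require Import structures.
From mathcomp Require Import all_boot all_algebra finmap.
From mathcomp.multinomials Require Import monalg.

Set Implicit Arguments.
Unset Strict Implicit.
Unset Printing Implicit Defensive.

Import GRing.Theory.
Local Open Scope fset_scope.
Local Open Scope ring_scope.

Section Rings.
Variable A : pzRingType.

Definition invertible (u : A) : Prop := exists v, u * v = 1 /\ v * u = 1.

Definition quasi_nilpotent (a : A) : Prop :=
  forall x, a * x = x * a -> invertible (1 - a * x).

Definition two_UQ : Prop :=
  forall u : A, invertible u ->
    exists e q : A,
      [/\ e * e = e, quasi_nilpotent q, e * q = q * e & u ^+ 2 = e + q].

Definition left_ideal (I : A -> Prop) : Prop :=
  [/\ I 0, forall x y, I x -> I y -> I (x + y) & forall a x, I x -> I (a * x)].

Definition maximal_left_ideal (I : A -> Prop) : Prop :=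
  [/\ left_ideal I, ~ I 1
    & forall K, left_ideal K -> ~ K 1 ->
        (forall x, I x -> K x) -> forall x, K x -> I x].

Definition jacobson_radical (a : A) : Prop :=
  forall I, maximal_left_ideal I -> I a.

End Rings.

Arguments two_UQ A : clear implicits.

Section Groups.
Variable G : groupType.

Definition has_order (g : G) (n : nat) : Prop :=
  [/\ (0 < n)%N, (g ^+ n = 1)%g
    & forall m, (0 < m)%N -> (g ^+ m = 1)%g -> (n <= m)%N].

Definition p_group (p : nat) : Prop :=
  forall g : G, exists k : nat, has_order g (p ^ k).

(* The exponent is the least positive one, so the trivial group has exponent 1
   and not 2. *)
Definition has_exponent (n : nat) : Prop :=
  [/\ (0 < n)%N, forall g : G, (g ^+ n = 1)%g
    & forall m, (0 < m)%N -> (forall g : G, (g ^+ m = 1)%g) -> (n <= m)%N].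

End Groups.

Arguments p_group G p : clear implicits.
Arguments has_exponent G n : clear implicits.

(* The additive group is that of monalg, i.e. finitely supported functions
   G -> R, with << r *g x >> standing for r x.  The product of monalg is not
   available: its monomType requires x * y = 1 -> x = 1 /\ y = 1, which fails
   in every nontrivial group. *)
Definition group_ring (R : nzRingType) (G : groupType) : predArgType :=
  {malg R[G]}.

HB.instance Definition _ (R : nzRingType) (G : groupType) :=
  GRing.Zmodule.copy (group_ring R G) {malg R[G]}.

Section GroupRing.
Variables (R : nzRingType) (G : groupType).
Implicit Types (a b c : group_ring R G) (x y : G) (r s : R).

Definition gr_one : group_ring R G := << 1 *g 1%g >>.

Definition gr_mul a b : group_ring R G :=
  \sum_(x <- msupp a) \sum_(y <- msupp b) << a@_x * b@_y *g (x * y)%g >>.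

Lemma gr_mulEw (d1 d2 : {fset G}) a b :
    msupp a `<=` d1 -> msupp b `<=` d2 ->
  gr_mul a b =
  \sum_(x <- d1) \sum_(y <- d2) << a@_x * b@_y *g (x * y)%g >>.
Proof.
move=> le_d1 le_d2; rewrite /gr_mul (big_fset_incl _ le_d1) /=.
  apply/eq_bigr=> x _; apply/big_fset_incl => // y _ /mcoeff_outdom ->.
  by rewrite mulr0 monalgU0.
move=> x _ /mcoeff_outdom ax0.
by rewrite big1 // => y _; rewrite ax0 mul0r monalgU0.
Qed.

Lemma gr_mulDl : left_distributive gr_mul +%R.
Proof.
move=> a b c.
rewrite [gr_mul a c](gr_mulEw (fsubsetUl _ (msupp b)) (fsubset_refl _)).
rewrite [gr_mul b c](gr_mulEw (fsubsetUr (msupp a) _) (fsubset_refl _)).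
rewrite (gr_mulEw (msuppD_le _ _) (fsubset_refl _)).
rewrite -big_split /=; apply/eq_bigr=> x _.
rewrite -big_split /=; apply/eq_bigr=> y _.
by rewrite mcoeffD mulrDl monalgUD.
Qed.

Lemma gr_mulDr : right_distributive gr_mul +%R.
Proof.
move=> a b c.
rewrite [gr_mul a b](gr_mulEw (fsubset_refl _) (fsubsetUl _ (msupp c))).
rewrite [gr_mul a c](gr_mulEw (fsubset_refl _) (fsubsetUr (msupp b) _)).
rewrite (gr_mulEw (fsubset_refl _) (msuppD_le _ _)).
rewrite -big_split /=; apply/eq_bigr=> x _.
rewrite -big_split /=; apply/eq_bigr=> y _.
by rewrite mcoeffD mulrDr monalgUD.
Qed.

Lemma gr_mul0l : left_zero 0 gr_mul.
Proof. by move=> a; rewrite /gr_mul msupp0 big_seq_fset0. Qed.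

Lemma gr_mul0r : right_zero 0 gr_mul.
Proof.
by move=> a; rewrite /gr_mul big1 // => x _; rewrite msupp0 big_seq_fset0.
Qed.

Lemma gr_mulUU r s x y :
  gr_mul << r *g x >> << s *g y >> = << r * s *g (x * y)%g >>.
Proof. by rewrite (gr_mulEw msuppU_le msuppU_le) !big_seq_fset1 !mcoeffUU. Qed.

Lemma gr_mul_suml I (t : seq I) (F : I -> group_ring R G) b :
  gr_mul (\sum_(i <- t) F i) b = \sum_(i <- t) gr_mul (F i) b.
Proof. exact: (big_morph (gr_mul^~ b) (fun _ _ => gr_mulDl _ _ _) (gr_mul0l _)). Qed.

Lemma gr_mul_sumr I (t : seq I) (F : I -> group_ring R G) a :
  gr_mul a (\sum_(i <- t) F i) = \sum_(i <- t) gr_mul a (F i).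
Proof. exact: (big_morph (gr_mul a) (fun _ _ => gr_mulDr _ _ _) (gr_mul0r _)). Qed.

Lemma gr_monalgE a : a = \sum_(x <- msupp a) (<< a@_x *g x >> : group_ring R G).
Proof. exact: monalgE. Qed.

Lemma gr_mulA : associative gr_mul.
Proof.
move=> a b c.
rewrite (gr_monalgE a) !gr_mul_suml; apply/eq_bigr=> x _.
rewrite (gr_monalgE b) gr_mul_suml !gr_mul_sumr gr_mul_suml.
apply/eq_bigr=> y _.
rewrite (gr_monalgE c) !gr_mul_sumr; apply/eq_bigr=> z _.
by rewrite !gr_mulUU mulrA mulgA.
Qed.

Lemma gr_mul1l : left_id gr_one gr_mul.
Proof.
move=> a; rewrite {1}(gr_monalgE a) gr_mul_sumr [RHS]gr_monalgE.
by apply/eq_bigr=> x _; rewrite gr_mulUU mul1r mul1g.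
Qed.

Lemma gr_mul1r : right_id gr_one gr_mul.
Proof.
move=> a; rewrite {1}(gr_monalgE a) gr_mul_suml [RHS]gr_monalgE.
by apply/eq_bigr=> x _; rewrite gr_mulUU mulr1 mulg1.
Qed.

Lemma gr_one_neq0 : gr_one != 0.
Proof. by rewrite monalgU_eq0 oner_eq0. Qed.

HB.instance Definition _ := GRing.Zmodule_isNzRing.Build (group_ring R G)
  gr_mulA gr_mul1l gr_mul1r gr_mulDl gr_mulDr gr_one_neq0.

End GroupRing.

(* Main.v *)
Require Import Defs.
From mathcomp Require Import all_boot all_algebra.
From mathcomp Require boolp classical_sets.
From mathcomp.multinomials Require Import monalg.

(** Every unit [u] of a 2-UQ ring satisfies [u ^ 2 = 1 + q] with [q]
    quasi-nilpotent, since an idempotent that differs from a unit by a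
    commuting quasi-nilpotent is a unit.  Suppose [p <> 3], let [g] be in [G]
    and [h = g ^ 2], of order [n] a power of [p].  As [3] lies in the Jacobson
    radical and [n] is prime to [3], [n] is a unit of [R].  Put
    [N = 1 + h + ... + h ^ (n - 1)].  Then [n - N] is a multiple of [h - 1],
    so [1 - (n - N) / n = N / n] is a unit, because [h - 1] is quasi-nilpotent.
    But [(h - 1) N = 0], so [h = 1]: every element of [G] squares to [1]. *)

Set Implicit Arguments.
Unset Strict Implicit.
Unset Printing Implicit Defensive.

Import GRing.Theory.
Local Open Scope ring_scope.

Section Rings.
Variable A : nzRingType.
Implicit Types (a b h q u v : A) (I : A -> Prop).

(** Zorn's lemma; needed because [jacobson_radical] is an intersection of maximal left ideals. *)
Lemma ex_maximal_left_ideal I :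
  left_ideal I -> ~ I 1 ->
  exists2 M, maximal_left_ideal M & forall x, I x -> M x.
Proof.
move=> idI I1.
(* The disjunction with [I] makes the empty chain harmless. *)
pose P (B : A -> Prop) :=
  left_ideal (fun x => I x \/ B x) /\ ~ (I 1 \/ B 1).
have [F FP totF|M [[idM M1] maxM]] := @classical_sets.Zorn_bigcup A P.
  split; last by case=> // -[X FX X1]; case: (FP _ FX) => _ []; right.
  case: (idI) => I0 ID IM; split; first by left.
  - have addIX X x y : F X -> I x -> X y ->
        I (x + y) \/ classical_sets.bigcup F id (x + y).
      move=> FX Ix Xy; case: (FP _ FX) => [[_ XD _] _].
      by case: (XD x y (or_introl Ix) (or_intror Xy)); [left | right; exists X].
    have addXX X x y : F X -> X x -> X y ->
        I (x + y) \/ classical_sets.bigcup F id (x + y).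
      move=> FX Xx Xy; case: (FP _ FX) => [[_ XD _] _].
      by case: (XD x y (or_intror Xx) (or_intror Xy)); [left | right; exists X].
    move=> x y [Ix|[X FX Xx]] [Iy|[Y FY Yy]].
    + by left; apply: ID.
    + exact: (addIX Y).
    + by rewrite addrC; apply: (addIX X).
    + case: (totF _ _ FX FY) => [XY|YX].
      * by apply: (addXX Y) => //; apply: XY.
      * by apply: (addXX X) => //; apply: YX.
  - move=> a x [Ix|[X FX Xx]]; first by left; apply: IM.
    case: (FP _ FX) => [[_ _ XM] _].
    by case: (XM a x (or_intror Xx)); [left | right; exists X].
exists (fun x => I x \/ M x); last by left.
split=> // K [K0 KD KM] K1 MK x Kx; apply: boolp.contrapT => nMx.
(* If [K] had an element [x] outside [I] and [M], it would be a strictly larger candidate than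
   [M]. *)
have IKE y : I y \/ K y -> K y by case=> // Iy; apply: MK; left.
apply: (maxM K); first split.
- by move=> y My; apply: MK; right.
- by move=> KM'; apply: nMx; right; apply: KM'.
- split; last by move/IKE.
  split; first by right.
  + by move=> y z /IKE Ky /IKE Kz; right; apply: KD.
  + by move=> a y /IKE Ky; right; apply: KM.
Qed.

(** Otherwise the left ideal of multiples of [b] lies in a maximal one, which also contains [a],
    hence [1]. *)
Lemma jacobson_radical_left_inv a b c d :
  jacobson_radical a -> c * a + d * b = 1 -> exists v, v * b = 1.
Proof.
move=> Ja cd1; apply: boolp.contrapT => nb.
have idb : left_ideal (fun x => exists v, v * b = x).
  split; first by exists 0; rewrite mul0r.
  - by move=> _ _ [v <-] [w <-]; exists (v + w); rewrite mulrDl.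
  - by move=> x _ [v <-]; exists (x * v); rewrite mulrA.
have [M maxM bM] := ex_maximal_left_ideal idb nb.
case: (maxM) => [[_ MD MM] M1 _]; apply: M1; rewrite -cd1.
apply: MD; first exact: MM (Ja _ maxM).
by apply: bM; exists d.
Qed.

Lemma jacobson_radical_natr_inv m n :
  jacobson_radical (m%:R : A) -> coprime n m -> invertible (n%:R : A).
Proof.
move=> Jm con.
have [v vn] : exists v, v * n%:R = 1 :> A.
  have [n0|n_gt0] := posnP n.
    move: con; rewrite n0 /coprime gcd0n => /eqP m1.
    by apply: (@jacobson_radical_left_inv m%:R _ 1 0); rewrite // m1 mul1r mul0r addr0.
  (* Bezout: [u * n = w * m + 1]. The left inverse obtained is two-sided because [n%:R] is
     central. *)
  case: (egcdnP m n_gt0) => u w e _.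
  rewrite (eqP con) in e.
  apply: (@jacobson_radical_left_inv m%:R _ (- w%:R) u%:R) => //.
  by rewrite mulNr -!natrM e natrD addrA addNr add0r.
by exists v; split=> //; rewrite -[RHS]vn; exact: commr_sym (commr_nat _ _).
Qed.

Lemma invertible_mul u v : invertible u -> invertible v -> invertible (u * v).
Proof.
move=> [u' [uu' u'u]] [v' [vv' v'v]]; exists (v' * u'); split.
  by rewrite mulrA -(mulrA u) vv' mulr1.
by rewrite mulrA -(mulrA v') u'u mulr1.
Qed.

Lemma invertible_comm_inv u a :
  invertible u -> u * a = a * u ->
  exists v, [/\ u * v = 1, v * u = 1 & v * a = a * v].
Proof.
move=> [v [uv vu]] ua; exists v; split=> //.
by rewrite -[LHS]mulr1 -uv mulrA -[v * a * u]mulrA -ua mulrA vu mul1r.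
Qed.

Lemma two_UQ_sqr_sub1 u :
  two_UQ A -> invertible u -> quasi_nilpotent (u ^+ 2 - 1).
Proof.
move=> A2 Uu; case: (A2 u Uu) => e [q [ee qQ eq uE]].
have Uu2 : invertible (u ^+ 2) by apply: invertible_mul.
have [w [uw wu wq]] : exists w, [/\ u ^+ 2 * w = 1, w * u ^+ 2 = 1 & w * q = q * w].
  by apply: invertible_comm_inv => //; rewrite uE mulrDl mulrDr eq.
(* Since [w] commutes with [q], the second factor is a unit; so [e] is an idempotent unit, that is
   [1]. *)
have eE : e = u ^+ 2 * (1 - q * w).
  by rewrite -wq mulrBr mulr1 mulrA uw mul1r uE addrK.
have [e' [ee' _]] : invertible e.
  by rewrite eE; apply: invertible_mul => //; apply: qQ.
have e1 : e = 1 by rewrite -[e]mulr1 -ee' mulrA ee.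
by rewrite uE e1 addrC addKr.
Qed.

Lemma torsion_quasi_nilpotent_sub1 h n :
  quasi_nilpotent (h - 1) -> h ^+ n = 1 -> invertible (n%:R : A) -> h = 1.
Proof.
move=> hQ hn Un.
have [v [nv vn vh]] : exists v, [/\ n%:R * v = 1, v * n%:R = 1 & v * h = h * v].
  by apply: invertible_comm_inv => //; exact: commr_sym (commr_nat _ _).
pose N := \sum_(i < n) h ^+ i.
(* The sum over [i < n] of the quotients of [h ^+ i - 1] by [h - 1]. *)
pose y := \sum_(i < n) \sum_(j < i) h ^+ j.
have hN : (h - 1) * N = 0 by rewrite -subrX1 hn subrr.
have hy : (h - 1) * y = N - n%:R.
  rewrite mulr_sumr (eq_bigr (fun i : 'I_n => h ^+ i - 1)) => [|i _].
    by rewrite sumrB sumr_const card_ord.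
  by rewrite -subrX1.
have cy : GRing.comm h y.
  by apply: commr_sum => i _; apply: commr_sum => j _; apply/commrX/commr_refl.
(* With this argument the unit given by quasi-nilpotence is [N * v], with inverse [s]. *)
have [|s [Ns _]] := hQ (- (y * v)).
  apply/commrN/commr_sym/commrB; last exact: commr1.
  by apply/commr_sym/commrM.
have NvE : 1 - (h - 1) * - (y * v) = N * v.
  by rewrite mulrN opprK mulrA hy mulrBl nv addrC subrK.
apply/subr0_eq; rewrite -[LHS]mulr1 -[X in _ * X]Ns NvE.
by rewrite !mulrA hN !mul0r.
Qed.

End Rings.

Section GroupRing.
Variables (R : nzRingType) (G : groupType).
Local Notation RG := (group_ring R G).

Definition gr_of (g : G) : RG := << 1 *g g >>.

Lemma gr_of1 : gr_of 1%g = 1. Proof. by []. Qed.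

Lemma gr_ofM g h : gr_of (g * h)%g = gr_of g * gr_of h.
Proof. by rewrite [RHS]gr_mulUU mulr1. Qed.

Lemma gr_ofX g n : gr_of (g ^+ n)%g = gr_of g ^+ n.
Proof. by elim: n => // n IHn; rewrite expgS gr_ofM IHn exprS. Qed.

Lemma gr_of_inj : injective gr_of.
Proof.
move=> g h /(congr1 (mcoeff h)); rewrite !mcoeffU eqxx.
by case: eqP => // _ /esym/eqP; rewrite oner_eq0.
Qed.

Lemma invertible_gr_of g : invertible (gr_of g).
Proof. by exists (gr_of g^-1%g); rewrite -!gr_ofM mulgV mulVg. Qed.

Lemma gr_natr n : n%:R = << n%:R *g 1%g >> :> RG.
Proof.
elim: n => [|n IHn]; first by rewrite monalgU0.
by rewrite -!natr1 IHn monalgUD.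
Qed.

Lemma invertible_gr_natr n : invertible (n%:R : R) -> invertible (n%:R : RG).
Proof.
move=> [v [nv vn]]; exists (<< v *g 1%g >>); rewrite gr_natr; split.
  by rewrite [LHS]gr_mulUU nv mulg1.
by rewrite [LHS]gr_mulUU vn mulg1.
Qed.

(** The previous results apply to the unit [gr_of g] and to [h = gr_of g ^+ 2]; injectivity of
    [gr_of] returns to [G]. *)
Lemma two_UQ_group_ring_sqr (g : G) n :
    two_UQ RG -> invertible (n%:R : R) -> (g ^+ n = 1)%g ->
  (g ^+ 2 = 1)%g.
Proof.
move=> RG2 Un gn; apply: gr_of_inj; rewrite gr_of1 gr_ofX.
apply: (@torsion_quasi_nilpotent_sub1 _ _ n).
- exact/two_UQ_sqr_sub1/invertible_gr_of.
- by rewrite -!gr_ofX expgnAC gn expg1n.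
- exact: invertible_gr_natr.
Qed.

End GroupRing.

Theorem theorem4p4 (R : nzRingType) (p : nat) (G : groupType) :
  jacobson_radical (3%:R : R)%R ->
  prime p ->
  p_group G p ->
  two_UQ (group_ring R G) ->
  p_group G 3 \/ has_exponent G 2.
Proof.
move=> J3 p_pr pG RG2.
have [p3|p_neq3] := eqVneq p 3%N; first by left; rewrite -p3.
have G2 (g : G) : (g ^+ 2 = 1)%g.
  have [k [_ gk _]] := pG g.
  apply: (two_UQ_group_ring_sqr RG2 _ gk).
  apply: jacobson_radical_natr_inv J3 _.
  by apply: coprimeXl; rewrite prime_coprime // dvdn_prime2.
(* The trivial group has exponent 1, so it is counted as a 3-group, with orders [3 ^ 0]. *)
have [G1|nG1] := boolp.EM (forall g : G, g = 1%g).
  by left=> g; exists 0%N; split=> //; rewrite (G1 g) expg1n.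
by right; split=> // -[|[|m]].
Qed.
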